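(* Let $\mathcal X=\mathcal{UD}(\mathcal V(D_5^{(1)}))=\mathbb Z^{10}$ be the crystal obtained by ultra-discretizing the positive geometric crystal $\mathcal V(D_5^{(1)})$, with the structure described in the context. The map $$\Omega:B^{5,\infty}\to\mathcal X,\qquad b=(b_{ij})_{i\le j\le i+4,\ 1\le i\le5}\mapsto x=(x_4^{(2)},x_3^{(3)},x_2^{(2)},x_5^{(2)},x_3^{(2)},x_4^{(1)},x_1^{(1)},x_2^{(1)},x_3^{(1)},x_5^{(1)})$$ defined by $$x_m^{(l)}=\begin{cases}\sum_{j=m-l+1}^{m}b_{m-l+1,j}, & m=1,2,3,\\[2pt] \sum_{j=m-2l+1}^{m}b_{m-2l+1,j}, & m=4,\\[2pt] \sum_{j=m-2l+1}^{m-1}b_{m-2l+1,j}, & m=5,\end{cases}$$ is an isomorphism of crystals; that is, $\Omega$ is a bijection commuting with $\tilde e_k$ and $\tilde f_k$ and preserving $\mathrm{wt}$, $\varepsilon_k$ and $\varphi_k$ for all $0\le k\le5$.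
   Context: **General.** $\mathfrak g=D_5^{(1)}$, $I=\{0,\dots,5\}$, fundamental weights $\Lambda_k$, $P_{cl}=\bigoplus_{k=0}^5\mathbb Z\Lambda_k$. Write $(x)_+=\max(x,0)$. ### The crystal $B^{5,\infty}$ $B^{5,\infty}$ is the set of $b=(b_{ij})_{1\le i\le5,\ i\le j\le i+4}$ with $b_{ij}\in\mathbb Z$, $\sum_{j=i}^{i+4}b_{ij}=0$ ($1\le i\le5$), and $\sum_{j=i}^{5-t}b_{ij}=\sum_{j=i+t}^{4+t}b_{i+t,j}$ ($1\le i,t\le4$, $i+t\le5$). Conditions, with $S=b_{14}-b_{22}-b_{23}+b_{33}+b_{34}$: - $(E_1)$: $b_{22}>b_{13}+b_{14}+b_{44}$, $b_{22}+b_{23}>b_{14}+b_{33}+b_{34}$, $b_{22}>b_{14}+b_{33}+(b_{13}-b_{24})_+$. - $(E_2)$: $b_{33}+b_{34}>b_{13}+b_{23}+b_{44}$, $b_{14}+b_{33}+b_{34}\ge b_{22}+b_{23}$, $b_{34}>b_{23}+(b_{13}-b_{24})_+$. - $(E_3)$: $b_{33}>b_{13}+b_{44}$, $b_{24}>b_{13}$, $b_{14}+b_{33}\ge b_{22}+(S)_+$. - $(E_4)$: $b_{33}>b_{24}+b_{44}$, $b_{13}\ge b_{24}$, $b_{13}+b_{14}+b_{33}\ge b_{22}+b_{24}+(S)_+$. - $(E_5)$: $b_{13}+b_{44}\ge b_{33}+(b_{13}-b_{24})_+$, $b_{13}+b_{14}+b_{44}\ge b_{22}+(S)_+$. $(F_j)$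 is $(E_j)$ with $>$ replaced by $\ge$ and $\ge$ replaced by $>$. Moves (''$+$'', ''$-$'' list the index pairs of entries increased, resp. decreased, by $1$): - $m_{0,1}$: $+$: 15,26,37,48,59; $-$: 11,22,35,46,57. - $m_{0,2}$: $+$: 14,25,37,48,59; $-$: 11,22,34,45,57. - $m_{0,3}$: $+$: 14,23,25,37,46,48,59; $-$: 11,22,24,33,45,47,56. - $m_{0,4}$: $+$: 13,25,36,48,59; $-$: 11,22,33,45,56. - $m_{0,5}$: $+$: 13,24,35,48,59; $-$: 11,22,33,44,55. - $m_{1}$: $+$: 11,58; $-$: 12,59. - $m_{2,1}$: $+$: 12,47; $-$: 13,48. $m_{2,2}$: $+$: 22,57; $-$: 23,58. - $m_{3,1}$: $+$: 13,36; $-$: 14,37. $m_{3,2}$: $+$: 23,46; $-$: 24,47. $m_{3,3}$: $+$: 33,56; $-$: 34,57. - $m_{4,1}$: $+$: 14,25; $-$: 15,26. $m_{4,2}$: $+$: 34,45; $-$: 35,46. - $m_{5,1}$: $+$: 24,35; $-$: 25,36. $m_{5,2}$: $+$: 44,55; $-$: 45,56. $\tilde e_k(b)$ applies: $k=0$: $m_{0,j}$ if $(E_j)$; $k=1$: $m_1$; $k=2$: $m_{2,1}$ if $b_{12}\ge b_{23}$, else $m_{2,2}$; $k=3$: $m_{3,1}$ if $b_{13}\ge b_{24}$ and $b_{13}+b_{23}\ge b_{24}+b_{34}$, $m_{3,2}$ if $b_{13}<b_{24}$ and $b_{23}\ge b_{34}$, $m_{3,3}$ if $b_{23}<b_{34}$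 and $b_{13}+b_{23}<b_{24}+b_{34}$; $k=4$: $m_{4,1}$ if $b_{14}+b_{33}+b_{34}\ge b_{22}+b_{23}$, else $m_{4,2}$; $k=5$: $m_{5,1}$ if $b_{24}+b_{44}\ge b_{33}$, else $m_{5,2}$. $\tilde f_k(b)$ applies the inverse (signs reversed) of: $k=0$: $m_{0,j}$ if $(F_j)$; $k=1$: $m_1$; $k=2$: $m_{2,1}$ if $b_{12}>b_{23}$, else $m_{2,2}$; $k=3$: $m_{3,1}$ if $b_{13}>b_{24}$ and $b_{13}+b_{23}>b_{24}+b_{34}$, $m_{3,2}$ if $b_{13}\le b_{24}$ and $b_{23}>b_{34}$, $m_{3,3}$ if $b_{23}\le b_{34}$ and $b_{13}+b_{23}\le b_{24}+b_{34}$; $k=4$: $m_{4,1}$ if $b_{14}+b_{33}+b_{34}>b_{22}+b_{23}$, else $m_{4,2}$; $k=5$: $m_{5,1}$ if $b_{24}+b_{44}>b_{33}$, else $m_{5,2}$. Functions on $B^{5,\infty}$: - $\varepsilon_0=\max\{-b_{45}-b_{46}-b_{47}-b_{48},\ -b_{13}-b_{34}-b_{35}-b_{36}-b_{37},\ -b_{24}-b_{34}-b_{35}-b_{36}-b_{37},\ -b_{13}-b_{14}-b_{23}-b_{24}-b_{25}-b_{26},\ -b_{13}-b_{23}-b_{35}-b_{36}-b_{37}\}$ - $\varepsilon_1=b_{12}$; $\varepsilon_2=\max\{b_{13},-b_{12}+b_{13}+b_{23}\}$ - $\varepsilon_3=\max\{b_{14},-b_{13}+b_{14}+b_{24},-b_{13}+b_{14}-b_{23}+b_{24}+b_{34}\}$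 - $\varepsilon_4=\max\{-b_{11}-b_{12}-b_{13}-b_{14},\ -b_{11}-b_{12}-b_{13}-2b_{14}+b_{22}+b_{23}-b_{33}-b_{34}\}$ - $\varepsilon_5=\max\{b_{11}+b_{12}+b_{13}-b_{22}-b_{23}-b_{24},\ b_{11}+b_{12}+b_{13}-b_{22}-b_{23}-2b_{24}+b_{33}-b_{44}\}$ - $\mathrm{wt}_0=-b_{11}-b_{12}+b_{23}+b_{24}+b_{25}+b_{26}$; $\mathrm{wt}_1=b_{11}-b_{12}-b_{22}$; $\mathrm{wt}_2=b_{12}-b_{13}+b_{22}-b_{23}-b_{33}$ - $\mathrm{wt}_3=b_{13}-b_{14}+b_{23}-b_{24}+b_{33}-b_{34}-b_{44}$ - $\mathrm{wt}_4=b_{11}+b_{12}+b_{13}+2b_{14}-b_{22}-b_{23}+b_{34}-b_{35}-b_{36}-b_{37}$ - $\mathrm{wt}_5=-b_{11}-b_{12}-b_{13}+b_{22}+b_{23}+2b_{24}-b_{33}+2b_{44}$ and $\varphi_k=\varepsilon_k+\mathrm{wt}_k$, $\mathrm{wt}=\sum_k\mathrm{wt}_k\Lambda_k$. ### The crystal $\mathcal X=\mathcal{UD}(\mathcal V(D_5^{(1)}))$ The ultra-discretization functor $\mathcal{UD}$ replaces, in a positive (subtraction-free) rational function, $\times\to+$, $/\to-$, $+\to\max$. The positive geometric crystal $\mathcal V(D_5^{(1)})$ has coordinates $x=(x_m^{(l)})\in(\mathbb C^\times)^{10}$, ordered as in the claim, and the following structure (unlisted coordinates unchanged). $e_1^c$: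 $x_1^{(1)}\mapsto cx_1^{(1)}$. $e_2^c$: $x_2^{(2)}\mapsto c_2x_2^{(2)}$, $x_2^{(1)}\mapsto\frac c{c_2}x_2^{(1)}$, $c_2=\frac{cx_2^{(2)}x_2^{(1)}+x_3^{(2)}x_1^{(1)}}{x_2^{(2)}x_2^{(1)}+x_3^{(2)}x_1^{(1)}}$. $e_3^c$: $x_3^{(3)}\mapsto c_{3_1}x_3^{(3)}$, $x_3^{(2)}\mapsto c_{3_2}x_3^{(2)}$, $x_3^{(1)}\mapsto\frac c{c_{3_1}c_{3_2}}x_3^{(1)}$, $c_{3_1}=\frac{cT_1+T_2+T_3}{T_1+T_2+T_3}$, $c_{3_2}=\frac{cT_1+cT_2+T_3}{cT_1+T_2+T_3}$, $T_1=x_3^{(3)}(x_3^{(2)})^2x_3^{(1)}$, $T_2=x_2^{(2)}x_5^{(2)}x_3^{(2)}x_3^{(1)}$, $T_3=x_2^{(2)}x_5^{(2)}x_4^{(1)}x_2^{(1)}$. $e_4^c$: $x_4^{(2)}\mapsto c_4x_4^{(2)}$, $x_4^{(1)}\mapsto\frac c{c_4}x_4^{(1)}$, $c_4=\frac{cx_4^{(2)}x_4^{(1)}+x_3^{(3)}x_3^{(2)}}{x_4^{(2)}x_4^{(1)}+x_3^{(3)}x_3^{(2)}}$. $e_5^c$: $x_5^{(2)}\mapsto c_5x_5^{(2)}$, $x_5^{(1)}\mapsto\frac c{c_5}x_5^{(1)}$, $c_5=\frac{cx_5^{(2)}x_5^{(1)}+x_3^{(2)}x_3^{(1)}}{x_5^{(2)}x_5^{(1)}+x_3^{(2)}x_3^{(1)}}$.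 $e_0^c$: with $p_0=x_5^{(1)}$, $p_1=\frac{x_2^{(2)}x_3^{(1)}}{x_3^{(3)}}$, $p_2=\frac{x_3^{(2)}x_3^{(1)}}{x_5^{(2)}}$, $p_3=\frac{x_2^{(2)}x_2^{(1)}}{x_4^{(2)}}$, $p_4=\frac{x_2^{(2)}x_4^{(1)}x_2^{(1)}}{x_3^{(3)}x_3^{(2)}}$ and $$q=p_0+p_1+p_2+p_3+p_4,\quad q_a=c(p_0+p_1+p_2+p_4)+p_3,\quad q_b=c(p_0+p_2)+p_1+p_3+p_4,$$ $$q_d=c(p_0+p_1+p_2)+p_3+p_4,\quad q_f=cp_0+p_1+p_2+p_3+p_4,$$ $$x_4^{(2)}\mapsto x_4^{(2)}\tfrac{q_a}{cq},\quad x_3^{(3)}\mapsto x_3^{(3)}\tfrac{q_b}{cq},\quad x_2^{(2)}\mapsto\tfrac{x_2^{(2)}}c,\quad x_5^{(2)}\mapsto x_5^{(2)}\tfrac{q_f}{cq},\quad x_3^{(2)}\mapsto x_3^{(2)}\tfrac{q_d}{cq_b},$$ $$x_4^{(1)}\mapsto x_4^{(1)}\tfrac{q}{q_a},\quad x_1^{(1)}\mapsto\tfrac{x_1^{(1)}}c,\quad x_2^{(1)}\mapsto\tfrac{x_2^{(1)}}c,\quad x_3^{(1)}\mapsto x_3^{(1)}\tfrac q{q_d},\quad x_5^{(1)}\mapsto x_5^{(1)}\tfrac q{q_f}.$$ The functions $\gamma_k,\varepsilon_k$ of $\mathcal V(D_5^{(1)})$ are the positive rational functions $$\gamma_0=\tfrac1{x_2^{(2)}x_2^{(1)}},\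 \gamma_1=\tfrac{(x_1^{(1)})^2}{x_2^{(2)}x_2^{(1)}},\ \gamma_2=\tfrac{(x_2^{(2)}x_2^{(1)})^2}{x_3^{(3)}x_3^{(2)}x_1^{(1)}x_3^{(1)}},\ \gamma_3=\tfrac{(x_3^{(3)}x_3^{(2)}x_3^{(1)})^2}{x_4^{(2)}x_2^{(2)}x_5^{(2)}x_4^{(1)}x_2^{(1)}x_5^{(1)}},\ \gamma_4=\tfrac{(x_4^{(2)}x_4^{(1)})^2}{x_3^{(3)}x_3^{(2)}x_3^{(1)}},\ \gamma_5=\tfrac{(x_5^{(2)}x_5^{(1)})^2}{x_3^{(3)}x_3^{(2)}x_3^{(1)}},$$ $$\varepsilon_0=q,\quad\varepsilon_1=\tfrac{x_2^{(2)}}{x_1^{(1)}},\quad\varepsilon_2=\tfrac{x_3^{(3)}}{x_2^{(2)}}\Big(1+\tfrac{x_3^{(2)}x_1^{(1)}}{x_2^{(2)}x_2^{(1)}}\Big),\quad\varepsilon_3=\tfrac{x_4^{(2)}}{x_3^{(3)}}\Big(1+\tfrac{x_2^{(2)}x_5^{(2)}}{x_3^{(3)}x_3^{(2)}}+\tfrac{x_2^{(2)}x_5^{(2)}x_4^{(1)}x_2^{(1)}}{x_3^{(3)}(x_3^{(2)})^2x_3^{(1)}}\Big),$$ $$\varepsilon_4=\tfrac1{x_4^{(2)}}\Big(1+\tfrac{x_3^{(3)}x_3^{(2)}}{x_4^{(2)}x_4^{(1)}}\Big),\quad\varepsilon_5=\tfrac{x_3^{(3)}}{x_5^{(2)}}\Big(1+\tfrac{x_3^{(2)}x_3^{(1)}}{x_5^{(2)}x_5^{(1)}}\Big).$$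 As a set $\mathcal X=\mathbb Z^{10}$, with coordinates denoted by the same symbols $x_m^{(l)}$. Its crystal structure is: $\tilde e_k(x)=\mathcal{UD}(e_k^c)(x)|_{c=1}$, $\tilde f_k(x)=\mathcal{UD}(e_k^c)(x)|_{c=-1}$ (here $c\in\mathbb Z$ is the tropical parameter), $\varepsilon_k(x)=\mathcal{UD}(\varepsilon_k)(x)$, $\mathrm{wt}_k(x)=\mathcal{UD}(\gamma_k)(x)$, $\mathrm{wt}(x)=\sum_k\mathrm{wt}_k(x)\Lambda_k$, $\varphi_k(x)=\mathrm{wt}_k(x)+\varepsilon_k(x)$. For instance, tropically $\mathcal{UD}(q_a)=\max\{c+P_0,c+P_1,c+P_2,c+P_4,P_3\}$ with $P_0=x_5^{(1)}$, $P_1=x_2^{(2)}-x_3^{(3)}+x_3^{(1)}$, $P_2=x_3^{(2)}-x_5^{(2)}+x_3^{(1)}$, $P_3=x_2^{(2)}-x_4^{(2)}+x_2^{(1)}$, $P_4=x_2^{(2)}-x_3^{(3)}+x_2^{(1)}-x_3^{(2)}+x_4^{(1)}$, so that e.g. $\mathcal{UD}(e_0^c)$ sends $x_4^{(2)}$ to $x_4^{(2)}+\mathcal{UD}(q_a)-c-\max\{P_0,\dots,P_4\}$. *)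

(* Defs.v *)
From HB Require Import structures.
From mathcomp Require Import all_boot all_order all_algebra.

Set Implicit Arguments.
Unset Strict Implicit.
Unset Printing Implicit Defensive.

Import Order.TTheory GRing.Theory Num.Theory.

(* P_cl as the free Z-module with basis Lambda_0, ..., Lambda_5. *)
Definition Pcl := 'rV[int]_6.
Definition Lambda (k : 'I_6) : Pcl := delta_mx ord0 k.

(* The operators take values in the crystal extended by the element 0,
   represented by [None].  Only the data of a crystal are recorded, not the
   axioms relating them: an isomorphism is a statement about the data. *)
Record crystal := Crystal {
  carrier :> Type;
  wt : carrier -> Pcl;
  eps : 'I_6 -> carrier -> int;
  phi : 'I_6 -> carrier -> int;
  etil : 'I_6 -> carrier -> option carrier;
  ftil : 'I_6 -> carrier -> option carrier
}.

Definition crystal_isomorphism (B C : crystal) (g : B -> C) : Prop :=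
  bijective g /\
  forall (k : 'I_6) (b : B),
    [/\ omap g (etil k b) = etil k (g b),
        omap g (ftil k b) = ftil k (g b),
        wt (g b) = wt b,
        eps k (g b) = eps k b &
        phi k (g b) = phi k b].

(* Row i of the array b holds b_{i,i}, ..., b_{i,i+4}: the entry b_{ij}
   (1 <= i <= 5, i <= j <= i+4) is stored at the 0-based position
   (i - 1, j - i). *)
Definition ent (b : 'M[int]_5) (i j : nat) : int :=
  b (inord i.-1) (inord (j - i)).

Definition in_B5inf (b : 'M[int]_5) : bool :=
  all (fun i => (\sum_(i <= j < i + 5) ent b i j == 0)%R) (iota 1 5) &&
  all (fun i => all (fun t => (i + t <= 5) ==>
         (\sum_(i <= j < (5 - t).+1) ent b i j ==
          \sum_(i + t <= j < (4 + t).+1) ent b (i + t) j)%R)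
       (iota 1 4)) (iota 1 4).

Definition B5inf := {b : 'M[int]_5 | in_B5inf b}.

(* A move is the pair of lists of indices (i, j) of the entries increased,
   resp. decreased, by 1. *)
Definition move := (seq (nat * nat) * seq (nat * nat))%type.

Definition m01 : move :=
  ([:: (1,5); (2,6); (3,7); (4,8); (5,9)],
   [:: (1,1); (2,2); (3,5); (4,6); (5,7)]).
Definition m02 : move :=
  ([:: (1,4); (2,5); (3,7); (4,8); (5,9)],
   [:: (1,1); (2,2); (3,4); (4,5); (5,7)]).
Definition m03 : move :=
  ([:: (1,4); (2,3); (2,5); (3,7); (4,6); (4,8); (5,9)],
   [:: (1,1); (2,2); (2,4); (3,3); (4,5); (4,7); (5,6)]).
Definition m04 : move :=
  ([:: (1,3); (2,5); (3,6); (4,8); (5,9)],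
   [:: (1,1); (2,2); (3,3); (4,5); (5,6)]).
Definition m05 : move :=
  ([:: (1,3); (2,4); (3,5); (4,8); (5,9)],
   [:: (1,1); (2,2); (3,3); (4,4); (5,5)]).
Definition m1  : move := ([:: (1,1); (5,8)], [:: (1,2); (5,9)]).
Definition m21 : move := ([:: (1,2); (4,7)], [:: (1,3); (4,8)]).
Definition m22 : move := ([:: (2,2); (5,7)], [:: (2,3); (5,8)]).
Definition m31 : move := ([:: (1,3); (3,6)], [:: (1,4); (3,7)]).
Definition m32 : move := ([:: (2,3); (4,6)], [:: (2,4); (4,7)]).
Definition m33 : move := ([:: (3,3); (5,6)], [:: (3,4); (5,7)]).
Definition m41 : move := ([:: (1,4); (2,5)], [:: (1,5); (2,6)]).
Definition m42 : move := ([:: (3,4); (4,5)], [:: (3,5); (4,6)]).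
Definition m51 : move := ([:: (2,4); (3,5)], [:: (2,5); (3,6)]).
Definition m52 : move := ([:: (4,4); (5,5)], [:: (4,5); (5,6)]).

Definition inv_move (m : move) : move := (m.2, m.1).

Local Open Scope ring_scope.

Definition move_mx (m : move) : 'M[int]_5 :=
  \matrix_(r < 5, s < 5)
    (((r.+1, r.+1 + s)%N \in m.1)%:R - ((r.+1, r.+1 + s)%N \in m.2)%:R).

Definition posp (a : int) : int := Num.max a 0.

Definition Sval (b : 'M[int]_5) : int :=
  ent b 1 4 - ent b 2 2 - ent b 2 3 + ent b 3 3 + ent b 3 4.

(* (E_j) is [cond0 gt ge] for gt = (>) and ge = (>=); (F_j) is obtained by
   exchanging the two relations. *)
Definition cond0 (gt ge : rel int) (b : 'M[int]_5) : seq bool :=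
  [:: [&& gt (ent b 2 2) (ent b 1 3 + ent b 1 4 + ent b 4 4),
          gt (ent b 2 2 + ent b 2 3) (ent b 1 4 + ent b 3 3 + ent b 3 4) &
          gt (ent b 2 2)
             (ent b 1 4 + ent b 3 3 + posp (ent b 1 3 - ent b 2 4))];
      [&& gt (ent b 3 3 + ent b 3 4) (ent b 1 3 + ent b 2 3 + ent b 4 4),
          ge (ent b 1 4 + ent b 3 3 + ent b 3 4) (ent b 2 2 + ent b 2 3) &
          gt (ent b 3 4) (ent b 2 3 + posp (ent b 1 3 - ent b 2 4))];
      [&& gt (ent b 3 3) (ent b 1 3 + ent b 4 4),
          gt (ent b 2 4) (ent b 1 3) &
          ge (ent b 1 4 + ent b 3 3) (ent b 2 2 + posp (Sval b))];
      [&& gt (ent b 3 3) (ent b 2 4 + ent b 4 4),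
          ge (ent b 1 3) (ent b 2 4) &
          ge (ent b 1 3 + ent b 1 4 + ent b 3 3)
             (ent b 2 2 + ent b 2 4 + posp (Sval b))];
      ge (ent b 1 3 + ent b 4 4)
         (ent b 3 3 + posp (ent b 1 3 - ent b 2 4)) &&
      ge (ent b 1 3 + ent b 1 4 + ent b 4 4) (ent b 2 2 + posp (Sval b))].

Definition gtz : rel int := fun a b => a > b.
Definition gez : rel int := fun a b => a >= b.

Definition e_cases (k : nat) (b : 'M[int]_5) : seq (bool * move) :=
  match k with
  | 0%N => zip (cond0 gtz gez b) [:: m01; m02; m03; m04; m05]
  | 1%N => [:: (true, m1)]
  | 2%N => [:: (ent b 1 2 >= ent b 2 3, m21);
               (~~ (ent b 1 2 >= ent b 2 3), m22)]
  | 3%N => [:: ((ent b 1 3 >= ent b 2 4) &&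
                (ent b 1 3 + ent b 2 3 >= ent b 2 4 + ent b 3 4), m31);
               ((ent b 1 3 < ent b 2 4) && (ent b 2 3 >= ent b 3 4), m32);
               ((ent b 2 3 < ent b 3 4) &&
                (ent b 1 3 + ent b 2 3 < ent b 2 4 + ent b 3 4), m33)]
  | 4%N => let c := ent b 1 4 + ent b 3 3 + ent b 3 4
                      >= ent b 2 2 + ent b 2 3 in
           [:: (c, m41); (~~ c, m42)]
  | _ => let c := ent b 2 4 + ent b 4 4 >= ent b 3 3 in
         [:: (c, m51); (~~ c, m52)]
  end.

Definition f_cases (k : nat) (b : 'M[int]_5) : seq (bool * move) :=
  match k with
  | 0%N => zip (cond0 gez gtz b) [:: m01; m02; m03; m04; m05]
  | 1%N => [:: (true, m1)]
  | 2%N => [:: (ent b 1 2 > ent b 2 3, m21);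
               (~~ (ent b 1 2 > ent b 2 3), m22)]
  | 3%N => [:: ((ent b 1 3 > ent b 2 4) &&
                (ent b 1 3 + ent b 2 3 > ent b 2 4 + ent b 3 4), m31);
               ((ent b 1 3 <= ent b 2 4) && (ent b 2 3 > ent b 3 4), m32);
               ((ent b 2 3 <= ent b 3 4) &&
                (ent b 1 3 + ent b 2 3 <= ent b 2 4 + ent b 3 4), m33)]
  | 4%N => let c := ent b 1 4 + ent b 3 3 + ent b 3 4
                      > ent b 2 2 + ent b 2 3 in
           [:: (c, m41); (~~ c, m42)]
  | _ => let c := ent b 2 4 + ent b 4 4 > ent b 3 3 in
         [:: (c, m51); (~~ c, m52)]
  end.

(* The result is an element of B^{5,oo} only when exactly one of the cases
   applies and the modified array satisfies the defining constraints of
   B^{5,oo}; otherwise it is 0 ([None]).  Since the operators of the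
   ultra-discretized crystal below never vanish, the compatibility of a
   map with the operators includes that this situation never occurs. *)
Definition B_etil (k : 'I_6) (b : B5inf) : option B5inf :=
  match [seq cm <- e_cases k (val b) | cm.1] with
  | [:: cm] => insub (val b + move_mx cm.2)
  | _ => None
  end.

Definition B_ftil (k : 'I_6) (b : B5inf) : option B5inf :=
  match [seq cm <- f_cases k (val b) | cm.1] with
  | [:: cm] => insub (val b + move_mx (inv_move cm.2))
  | _ => None
  end.

Definition B_eps (k : nat) (b : 'M[int]_5) : int :=
  match k with
  | 0%N =>
      Num.max (- ent b 4 5 - ent b 4 6 - ent b 4 7 - ent b 4 8)
     (Num.max (- ent b 1 3 - ent b 3 4 - ent b 3 5 - ent b 3 6 - ent b 3 7)
     (Num.max (- ent b 2 4 - ent b 3 4 - ent b 3 5 - ent b 3 6 - ent b 3 7)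
     (Num.max (- ent b 1 3 - ent b 1 4 - ent b 2 3 - ent b 2 4 - ent b 2 5
               - ent b 2 6)
              (- ent b 1 3 - ent b 2 3 - ent b 3 5 - ent b 3 6
               - ent b 3 7))))
  | 1%N => ent b 1 2
  | 2%N => Num.max (ent b 1 3) (- ent b 1 2 + ent b 1 3 + ent b 2 3)
  | 3%N =>
      Num.max (ent b 1 4)
     (Num.max (- ent b 1 3 + ent b 1 4 + ent b 2 4)
              (- ent b 1 3 + ent b 1 4 - ent b 2 3 + ent b 2 4 + ent b 3 4))
  | 4%N =>
      Num.max (- ent b 1 1 - ent b 1 2 - ent b 1 3 - ent b 1 4)
              (- ent b 1 1 - ent b 1 2 - ent b 1 3 - 2 * ent b 1 4
               + ent b 2 2 + ent b 2 3 - ent b 3 3 - ent b 3 4)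
  | _ =>
      Num.max (ent b 1 1 + ent b 1 2 + ent b 1 3
               - ent b 2 2 - ent b 2 3 - ent b 2 4)
              (ent b 1 1 + ent b 1 2 + ent b 1 3
               - ent b 2 2 - ent b 2 3 - 2 * ent b 2 4
               + ent b 3 3 - ent b 4 4)
  end.

Definition B_wt (k : nat) (b : 'M[int]_5) : int :=
  match k with
  | 0%N => - ent b 1 1 - ent b 1 2 + ent b 2 3 + ent b 2 4 + ent b 2 5
           + ent b 2 6
  | 1%N => ent b 1 1 - ent b 1 2 - ent b 2 2
  | 2%N => ent b 1 2 - ent b 1 3 + ent b 2 2 - ent b 2 3 - ent b 3 3
  | 3%N => ent b 1 3 - ent b 1 4 + ent b 2 3 - ent b 2 4 + ent b 3 3
           - ent b 3 4 - ent b 4 4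
  | 4%N => ent b 1 1 + ent b 1 2 + ent b 1 3 + 2 * ent b 1 4
           - ent b 2 2 - ent b 2 3 + ent b 3 4
           - ent b 3 5 - ent b 3 6 - ent b 3 7
  | _ => - ent b 1 1 - ent b 1 2 - ent b 1 3 + ent b 2 2 + ent b 2 3
         + 2 * ent b 2 4 - ent b 3 3 + 2 * ent b 4 4
  end.

Definition B5inf_crystal : crystal :=
  @Crystal B5inf
    (fun b => \sum_(k < 6) B_wt k (val b) *: Lambda k)
    (fun k b => B_eps k (val b))
    (fun k b => B_eps k (val b) + B_wt k (val b))
    B_etil
    B_ftil.

(* Subtraction-free rational expressions in the coordinates x_m^(l) ([RX m l])
   and the parameter c ([RC]). *)
Inductive posrat : Type :=
| ROne : posrat
| RC : posrat
| RX : nat -> nat -> posrat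
| RAdd : posrat -> posrat -> posrat
| RMul : posrat -> posrat -> posrat
| RDiv : posrat -> posrat -> posrat.

Declare Scope posrat_scope.
Delimit Scope posrat_scope with P.
Bind Scope posrat_scope with posrat.
Notation "1" := ROne : posrat_scope.
Infix "+" := RAdd : posrat_scope.
Infix "*" := RMul : posrat_scope.
Infix "/" := RDiv : posrat_scope.

Fixpoint UD (c : int) (x : nat -> nat -> int) (f : posrat) : int :=
  match f with
  | ROne => 0
  | RC => c
  | RX m l => x m l
  | RAdd f1 f2 => Num.max (UD c x f1) (UD c x f2)
  | RMul f1 f2 => UD c x f1 + UD c x f2
  | RDiv f1 f2 => UD c x f1 - UD c x f2
  end.

(* The pairs (m, l), in the order in which the coordinates x_m^(l) are
   listed. *)
Definition coords : seq (nat * nat) :=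
  [:: (4, 2); (3, 3); (2, 2); (5, 2); (3, 2);
      (4, 1); (1, 1); (2, 1); (3, 1); (5, 1)]%N.

Section GeometricCrystal.
Local Open Scope posrat_scope.

Definition sq (f : posrat) : posrat := f * f.

Definition p0 : posrat := RX 5 1.
Definition p1 : posrat := RX 2 2 * RX 3 1 / RX 3 3.
Definition p2 : posrat := RX 3 2 * RX 3 1 / RX 5 2.
Definition p3 : posrat := RX 2 2 * RX 2 1 / RX 4 2.
Definition p4 : posrat := RX 2 2 * RX 4 1 * RX 2 1 / (RX 3 3 * RX 3 2).
Definition q : posrat := p0 + p1 + p2 + p3 + p4.
Definition qa : posrat := RC * (p0 + p1 + p2 + p4) + p3.
Definition qb : posrat := RC * (p0 + p2) + p1 + p3 + p4.
Definition qd : posrat := RC * (p0 + p1 + p2) + p3 + p4.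
Definition qf : posrat := RC * p0 + p1 + p2 + p3 + p4.

Definition c2 : posrat :=
  (RC * RX 2 2 * RX 2 1 + RX 3 2 * RX 1 1) /
  (RX 2 2 * RX 2 1 + RX 3 2 * RX 1 1).

Definition T1 : posrat := RX 3 3 * sq (RX 3 2) * RX 3 1.
Definition T2 : posrat := RX 2 2 * RX 5 2 * RX 3 2 * RX 3 1.
Definition T3 : posrat := RX 2 2 * RX 5 2 * RX 4 1 * RX 2 1.
Definition c31 : posrat := (RC * T1 + T2 + T3) / (T1 + T2 + T3).
Definition c32 : posrat := (RC * T1 + RC * T2 + T3) / (RC * T1 + T2 + T3).

Definition c4 : posrat :=
  (RC * RX 4 2 * RX 4 1 + RX 3 3 * RX 3 2) /
  (RX 4 2 * RX 4 1 + RX 3 3 * RX 3 2).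

Definition c5 : posrat :=
  (RC * RX 5 2 * RX 5 1 + RX 3 2 * RX 3 1) /
  (RX 5 2 * RX 5 1 + RX 3 2 * RX 3 1).

(* The image of the coordinate x_m^(l) under e_k^c. *)
Definition V_e (k m l : nat) : posrat :=
  match k, m, l with
  | 0%N, 4%N, 2%N => RX 4 2 * (qa / (RC * q))
  | 0%N, 3%N, 3%N => RX 3 3 * (qb / (RC * q))
  | 0%N, 2%N, 2%N => RX 2 2 / RC
  | 0%N, 5%N, 2%N => RX 5 2 * (qf / (RC * q))
  | 0%N, 3%N, 2%N => RX 3 2 * (qd / (RC * qb))
  | 0%N, 4%N, 1%N => RX 4 1 * (q / qa)
  | 0%N, 1%N, 1%N => RX 1 1 / RC
  | 0%N, 2%N, 1%N => RX 2 1 / RC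
  | 0%N, 3%N, 1%N => RX 3 1 * (q / qd)
  | 0%N, 5%N, 1%N => RX 5 1 * (q / qf)
  | 1%N, 1%N, 1%N => RC * RX 1 1
  | 2%N, 2%N, 2%N => c2 * RX 2 2
  | 2%N, 2%N, 1%N => RC / c2 * RX 2 1
  | 3%N, 3%N, 3%N => c31 * RX 3 3
  | 3%N, 3%N, 2%N => c32 * RX 3 2
  | 3%N, 3%N, 1%N => RC / (c31 * c32) * RX 3 1
  | 4%N, 4%N, 2%N => c4 * RX 4 2
  | 4%N, 4%N, 1%N => RC / c4 * RX 4 1
  | 5%N, 5%N, 2%N => c5 * RX 5 2
  | 5%N, 5%N, 1%N => RC / c5 * RX 5 1
  | _, _, _ => RX m l
  end.

Definition V_gamma (k : nat) : posrat :=
  match k with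
  | 0%N => 1 / (RX 2 2 * RX 2 1)
  | 1%N => sq (RX 1 1) / (RX 2 2 * RX 2 1)
  | 2%N => sq (RX 2 2 * RX 2 1) / (RX 3 3 * RX 3 2 * RX 1 1 * RX 3 1)
  | 3%N => sq (RX 3 3 * RX 3 2 * RX 3 1) /
           (RX 4 2 * RX 2 2 * RX 5 2 * RX 4 1 * RX 2 1 * RX 5 1)
  | 4%N => sq (RX 4 2 * RX 4 1) / (RX 3 3 * RX 3 2 * RX 3 1)
  | _ => sq (RX 5 2 * RX 5 1) / (RX 3 3 * RX 3 2 * RX 3 1)
  end.

Definition V_eps (k : nat) : posrat :=
  match k with
  | 0%N => q
  | 1%N => RX 2 2 / RX 1 1
  | 2%N => RX 3 3 / RX 2 2 * (1 + RX 3 2 * RX 1 1 / (RX 2 2 * RX 2 1))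
  | 3%N => RX 4 2 / RX 3 3 *
           (1 + RX 2 2 * RX 5 2 / (RX 3 3 * RX 3 2)
              + RX 2 2 * RX 5 2 * RX 4 1 * RX 2 1 /
                (RX 3 3 * sq (RX 3 2) * RX 3 1))
  | 4%N => 1 / RX 4 2 * (1 + RX 3 3 * RX 3 2 / (RX 4 2 * RX 4 1))
  | _ => RX 3 3 / RX 5 2 * (1 + RX 3 2 * RX 3 1 / (RX 5 2 * RX 5 1))
  end.

End GeometricCrystal.

Definition XT := 'rV[int]_10.

Definition coord (x : XT) (m l : nat) : int :=
  x ord0 (inord (index (m, l) coords)).

Definition mkX (g : nat -> nat -> int) : XT :=
  \row_(a < 10) g (nth (0, 0)%N coords a).1 (nth (0, 0)%N coords a).2.

Definition X_e (c : int) (k : nat) (x : XT) : XT :=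
  mkX (fun m l => UD c (coord x) (V_e k m l)).

(* The expressions for eps_k and gamma_k do not involve c, so the value of
   c chosen here is immaterial. *)
Definition X_eps (k : nat) (x : XT) : int := UD 0 (coord x) (V_eps k).
Definition X_wt (k : nat) (x : XT) : int := UD 0 (coord x) (V_gamma k).

Definition X_crystal : crystal :=
  @Crystal XT
    (fun x => \sum_(k < 6) X_wt k x *: Lambda k)
    (fun k x => X_eps k x)
    (fun k x => X_wt k x + X_eps k x)
    (fun k x => Some (X_e 1 k x))
    (fun k x => Some (X_e (-1) k x)).

(* The nat subtractions below are not truncated at the ten coordinates
   (m, l); in the case m = 5 the upper bound of summation is m - 1. *)
Definition Omega_coord (b : 'M[int]_5) (m l : nat) : int :=
  if (m <= 3)%N then
    \sum_(m.+1 - l <= j < m.+1) ent b (m.+1 - l) j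
  else if (m == 4)%N then
    \sum_(m.+1 - 2 * l <= j < m.+1) ent b (m.+1 - 2 * l) j
  else
    \sum_(m.+1 - 2 * l <= j < m) ent b (m.+1 - 2 * l) j.

Definition Omega (b : B5inf_crystal) : X_crystal :=
  mkX (Omega_coord (val (b : B5inf))).

(* Main.v *)
(* Every b in B^{5,oo} is determined by ten of its partial row sums, and these
   are the coordinates of Omega b, so Omega is a linear bijection.  In these
   coordinates the crystal data on both sides are piecewise linear.  For k = 0,
   write P_0, ..., P_4 for the tropicalizations of p_0, ..., p_4: the conditions
   E_j (resp. F_j) say which P_i is the maximum, ties being broken by the fixed
   priority 0, 2, 1, 4, 3 (resp. the reverse one).  So exactly one of them holds,
   and since the tropical parameter is 1 or -1, knowing this P_i determines the
   tropical values of q, q_a, q_b, q_d, q_f. *)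
From HB Require Import structures.
From mathcomp Require Import all_boot all_order all_algebra.
From mathcomp Require Import zify.
Require Import Defs.

Set Implicit Arguments.
Unset Strict Implicit.
Unset Printing Implicit Defensive.

Import Order.TTheory GRing.Theory Num.Theory.
Local Open Scope ring_scope.

(** * The inverse of Omega *)

(* Row i lists the coordinates equal to the partial sums of row i of b,
   which the constraints of B^{5,oo} identify with those of other rows. *)
Definition psum_coords : seq (seq (nat * nat)) :=
  [:: [:: (1, 1); (2, 2); (3, 3); (4, 2)];
      [:: (2, 1); (3, 2); (5, 2); (4, 2)];
      [:: (3, 1); (4, 1); (5, 2); (3, 3)];
      [:: (5, 1); (4, 1); (3, 2); (2, 2)];
      [:: (5, 1); (3, 1); (2, 1); (1, 1)]]%N.

(** The value 0 at [s = 5] encodes that each row of an array in B^{5,oo} sums to 0. *)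
Definition psum (x : XT) (r s : nat) : int :=
  if s is s'.+1 then
    if (s' < 4)%N then
      let ml := nth (0, 0)%N (nth [::] psum_coords r) s' in coord x ml.1 ml.2
    else 0
  else 0.

Definition Xi (x : XT) : 'M[int]_5 :=
  \matrix_(r < 5, s < 5) (psum x r s.+1 - psum x r s).

(* [inord] sends out-of-range indices to 0; stating this makes the equation
   unconditional, so that rewriting with it produces no side goals. *)
Lemma ent_Xi (x : XT) (i j : nat) (r := if (i.-1 < 5)%N then i.-1 else 0%N)
    (s := if (j - i < 5)%N then (j - i)%N else 0%N) :
  ent (Xi x) i j = psum x r s.+1 - psum x r s.
Proof. by rewrite /ent mxE !val_insubd. Qed.

Lemma coord_mkX (g : nat -> nat -> int) (m l : nat) :
  (m, l) \in coords -> coord (mkX g) m l = g m l.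
Proof.
move=> ml_in; have lt_ml : (index (m, l) coords < 10)%N by rewrite index_mem.
by rewrite /coord mxE inordK // nth_index.
Qed.

Lemma eq_XT (x y : XT) :
  (forall m l, (m, l) \in coords -> coord x m l = coord y m l) -> x = y.
Proof.
move=> eqxy; apply/rowP => a; have lt_a : (a < size coords)%N by [].
have := mem_nth (0, 0)%N lt_a; case Ea: (nth _ _ _) => [m l] /eqxy.
by rewrite /coord -Ea index_uniq // inord_val.
Qed.

Lemma eq_array (a b : 'M[int]_5) :
  foldr and True
    [seq ent a i j = ent b i j | i <- iota 1 5, j <- iota i 5] -> a = b.
Proof.
move=> /= eqab; have {}eqab i j : (0 < i <= 5)%N -> (i <= j < i + 5)%N ->
    ent a i j = ent b i j.
  by case: i => [|[|[|[|[|[|i]]]]]] //= _;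
    do 10?[case: j => [|j] //] => _; tauto.
apply/matrixP => r s.
have := eqab r.+1 (r.+1 + s)%N; rewrite /ent addKn !inord_val; apply.
  by rewrite ltnS ltn_ord.
by rewrite leq_addr ltn_add2l ltn_ord.
Qed.

Ltac expand_sums := rewrite unlock /= ?(addSn, add0n, subSS, subn0).

Lemma Xi_in (x : XT) : in_B5inf (Xi x).
Proof.
rewrite /in_B5inf /=; expand_sums; rewrite !ent_Xi /= /psum /=; lia.
Qed.

Lemma Omega_XiK (x : XT) : mkX (Omega_coord (Xi x)) = x.
Proof.
apply: eq_XT => m l ml; rewrite coord_mkX //; move: ml.
rewrite !inE !xpair_eqE /=.
by do ![case/orP] => /andP[/eqP-> /eqP->]; rewrite /Omega_coord /=; expand_sums;
   rewrite !ent_Xi /= /psum /=; lia.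
Qed.

Lemma Xi_OmegaK (b : 'M[int]_5) :
  in_B5inf b -> Xi (mkX (Omega_coord b)) = b.
Proof.
rewrite /in_B5inf /=; expand_sums => bP; apply: eq_array => /=.
rewrite !ent_Xi /= /psum /= !coord_mkX // /Omega_coord /=; expand_sums.
by do ?[split=> //]; lia.
Qed.

Lemma B_eps_Xi (k : 'I_6) (x : XT) : B_eps k (Xi x) = X_eps k x.
Proof.
rewrite /X_eps; case: k => [[|[|[|[|[|[|//]]]]]] ?] /=;
  rewrite !ent_Xi /= /psum /=; lia.
Qed.

Lemma B_wt_Xi (k : 'I_6) (x : XT) : B_wt k (Xi x) = X_wt k x.
Proof.
rewrite /X_wt; case: k => [[|[|[|[|[|[|//]]]]]] ?] /=;
  rewrite !ent_Xi /= /psum /=; lia.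
Qed.

(** * Moves, and the operators for k = 0 *)

Lemma ent_add_move (a : 'M[int]_5) (m : move) (i j : nat) :
  (0 < i <= 5)%N -> (i <= j < i + 5)%N ->
  ent (a + move_mx m) i j
  = ent a i j + (((i, j) \in m.1)%:R - ((i, j) \in m.2)%:R).
Proof.
move=> iP jP; rewrite /ent !mxE !inordK; [|lia|lia].
by have [-> ->] : (i.-1.+1 = i /\ i + (j - i) = j)%N by lia.
Qed.

(* Throughout, the boolean e selects the operators: true for e_k, false for
   f_k, the latter exchanging > and >= and reversing c and the moves. *)
Definition rgt (e : bool) : rel int := if e then gtz else gez.

Definition Pval (x : XT) (k : nat) : int :=
  UD 0 (coord x) (nth p0 [:: p0; p1; p2; p3; p4] k).

Definition argmax_conds (gt ge : rel int) (a : nat -> int) : seq bool :=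
  [:: [&& gt (a 3) (a 0), gt (a 3) (a 4), gt (a 3) (a 1) & gt (a 3) (a 2)];
      [&& gt (a 4) (a 0), ge (a 4) (a 3), gt (a 4) (a 1) & gt (a 4) (a 2)];
      [&& gt (a 1) (a 0), gt (a 1) (a 2), ge (a 1) (a 3) & ge (a 1) (a 4)];
      [&& gt (a 2) (a 0), ge (a 2) (a 1), ge (a 2) (a 3) & ge (a 2) (a 4)];
      [&& ge (a 0) (a 1), ge (a 0) (a 2), ge (a 0) (a 3) & ge (a 0) (a 4)]]%N.

(* The i such that E_(j+1) makes P_i the maximum. *)
Definition argmax_index (j : nat) : nat := nth 0%N [:: 3; 4; 1; 2; 0]%N j.

(** Each [posp] splits into two inequalities, so every E_j amounts to four, each comparing two of
    the P_i. *)
Lemma cond0_Xi (e : bool) (x : XT) :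
  cond0 (rgt e) (rgt (~~ e)) (Xi x) =
  argmax_conds (rgt e) (rgt (~~ e)) (Pval x).
Proof.
rewrite /cond0 /Sval /posp !ent_Xi /= /psum /argmax_conds /Pval /=.
by case: e; rewrite /rgt /gtz /gez /=; do !congr (_ :: _); lia.
Qed.

(** Ordering the indices by value, with ties broken by priority, is a total order, so exactly one
    index is greatest. *)
Lemma argmax_condsP (e : bool) (a : nat -> int) :
  exists2 j, (j < 5)%N &
    argmax_conds (rgt e) (rgt (~~ e)) a = [seq k == j | k <- iota 0 5].
Proof.
pose s := argmax_conds (rgt e) (rgt (~~ e)) a.
have : [|| nth true s 0, nth true s 1, nth true s 2, nth true s 3
         | nth true s 4].
  by rewrite /s /rgt; case: e {s}; rewrite /gtz /gez /=; lia.
have eq5 (c1 c2 c3 c4 c5 d1 d2 d3 d4 d5 : bool) :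
    c1 = d1 -> c2 = d2 -> c3 = d3 -> c4 = d4 -> c5 = d5 ->
    [:: c1; c2; c3; c4; c5] = [:: d1; d2; d3; d4; d5].
  by move=> -> -> -> -> ->.
case/or4P => [||| /orP[]] /= h;
  [exists 0%N|exists 1%N|exists 2%N|exists 3%N|exists 4%N] => //;
  move: h; rewrite {}/s; case: e; rewrite /rgt /gtz /gez /argmax_conds /= => h;
  by apply: eq5; lia.
Qed.

Lemma UD_qE (c : int) (x : XT) (a0 := Pval x 0) (a1 := Pval x 1)
    (a2 := Pval x 2) (a3 := Pval x 3) (a4 := Pval x 4) (Q := UD c (coord x)) :
  (Q q = Num.max (Num.max (Num.max (Num.max a0 a1) a2) a3) a4) *
  (Q qa = Num.max (c + Num.max (Num.max (Num.max a0 a1) a2) a4) a3) *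
  (Q qb = Num.max (Num.max (Num.max (c + Num.max a0 a2) a1) a3) a4) *
  (Q qd = Num.max (Num.max (c + Num.max (Num.max a0 a1) a2) a3) a4) *
  (Q qf = Num.max (Num.max (Num.max (Num.max (c + a0) a1) a2) a3) a4).
Proof. by []. Qed.

Definition dir (e : bool) : int := if e then 1 else -1.

(** The terms carrying [c] in [qf], [qb], [qd], [qa] form the initial segments 0; 0,2; 0,2,1;
    0,2,1,4 of the priority. Hence a term can gain 1 on the selected P_i only if P_i strictly
    exceeds it, by at least 1 since values are integers; so P_i stays a maximum. *)
Lemma UD_q_argmax (e : bool) (x : XT) (j : nat) (i := argmax_index j) :
  (j < 5)%N -> nth true (argmax_conds (rgt e) (rgt (~~ e)) (Pval x)) j ->
  [/\ UD (dir e) (coord x) q = Pval x i,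
      UD (dir e) (coord x) qa
        = Pval x i + (i \in [:: 0; 1; 2; 4]%N)%:R * dir e,
      UD (dir e) (coord x) qb = Pval x i + (i \in [:: 0; 2]%N)%:R * dir e,
      UD (dir e) (coord x) qd = Pval x i + (i \in [:: 0; 1; 2]%N)%:R * dir e &
      UD (dir e) (coord x) qf = Pval x i + (i == 0%N)%:R * dir e].
Proof.
rewrite {}/i !UD_qE; move: (Pval x) => P.
do 5?[case: j => [|j] //] => _; rewrite /argmax_index /argmax_conds /=;
  case: e; rewrite /rgt /gtz /gez /dir /= => h;
  split; apply/le_anti; rewrite !(ge_max, le_max); lia.
Qed.

Lemma coord_X_e0 (c : int) (x : XT) (y := X_e c 0 x) (Q := UD c (coord x)) :
  (coord y 4 2 = coord x 4 2 + (Q qa - (c + Q q))) *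
  (coord y 3 3 = coord x 3 3 + (Q qb - (c + Q q))) *
  (coord y 2 2 = coord x 2 2 - c) *
  (coord y 5 2 = coord x 5 2 + (Q qf - (c + Q q))) *
  (coord y 3 2 = coord x 3 2 + (Q qd - (c + Q qb))) *
  (coord y 4 1 = coord x 4 1 + (Q q - Q qa)) *
  (coord y 1 1 = coord x 1 1 - c) *
  (coord y 2 1 = coord x 2 1 - c) *
  (coord y 3 1 = coord x 3 1 + (Q q - Q qd)) *
  (coord y 5 1 = coord x 5 1 + (Q q - Q qf)).
Proof. by rewrite /y !coord_mkX. Qed.

Definition cases (e : bool) := if e then e_cases else f_cases.
Definition dir_move (e : bool) (m : move) := if e then m else inv_move m.

(** Requiring the moved array to be of the form [Xi] also yields its membership in B^{5,oo}, by
    [Xi_in]. *)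
Definition unique_move (e : bool) (k : nat) (x : XT) : Prop :=
  exists2 cm, [seq cm <- cases e k (Xi x) | cm.1] = [:: cm] &
              Xi x + move_mx (dir_move e cm.2) = Xi (X_e (dir e) k x).

Ltac generalize_coords :=
  repeat match goal with |- context[coord ?x ?m ?l] =>
    let a := fresh "a" in set a := (coord x m l) in *; clearbody a
  end.

Lemma unique_move0 (e : bool) (x : XT) : unique_move e 0 x.
Proof.
have [j ltj E] := argmax_condsP e (Pval x).
have : nth true (argmax_conds (rgt e) (rgt (~~ e)) (Pval x)) j.
  by rewrite E; case: j ltj {E} => [|[|[|[|[|]]]]].
move/(UD_q_argmax ltj) => UDq.
have Ecases : cases e 0 (Xi x) =
    zip [seq k == j | k <- iota 0 5] [:: m01; m02; m03; m04; m05].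
  by rewrite -E -cond0_Xi; case: e {E UDq}.
rewrite /unique_move {}Ecases {E}.
case: j ltj UDq => [|[|[|[|[|//]]]]] _ [Eq Eqa Eqb Eqd Eqf];
  (eexists; [reflexivity|]); apply: eq_array;
  case: e Eq Eqa Eqb Eqd Eqf => Eq Eqa Eqb Eqd Eqf;
  rewrite /dir_move [X_e _]lock /= -lock;
  rewrite !ent_add_move // !ent_Xi /= /psum /=;
  (* Only differences of these five values occur, so the common P_i cancels. *)
  rewrite !coord_X_e0 !(Eq, Eqa, Eqb, Eqd, Eqf) /dir /=; clear;
  do ?[split => //]; generalize_coords; lia.
Qed.

(** * The operators for k > 0 *)

Ltac decide_cases :=
  repeat match goal with |- context[if ?c then _ else _] =>
    first [have -> : c = true by lia | have -> : c = false by lia]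
  end.

Ltac solve_move :=
  rewrite /unique_move /cases /dir_move /=; rewrite ?ent_Xi /= /psum /=;
  eexists; [rewrite /=; decide_cases; reflexivity |];
  apply: eq_array => /=; rewrite !ent_add_move // !ent_Xi /= /psum /=;
  rewrite !coord_mkX //=; do ?[split=> //]; generalize_coords; lia.

Lemma unique_move1 (e : bool) (x : XT) : unique_move e 1 x.
Proof. case: e; solve_move. Qed.

(** For k = 2, 4, 5 the test compares the two terms in the denominator of c_k; the tropical c_k is
    [c] if the first is selected and 0 otherwise. *)
Lemma unique_move2 (e : bool) (x : XT) : unique_move e 2 x.
Proof.
case: (boolP (rgt (~~ e) (ent (Xi x) 1 2) (ent (Xi x) 2 3))); case: e;
  rewrite /rgt /gtz /gez !ent_Xi /= /psum /= => h; solve_move.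
Qed.

(** The tests compare the tropical [T1], [T2], [T3]: the largest selects the move, ties going to the
    smaller index for e_3 and to the larger for f_3. *)
Lemma unique_move3 (e : bool) (x : XT) : unique_move e 3 x.
Proof.
have /or3P[] : [|| rgt (~~ e) (ent (Xi x) 1 3) (ent (Xi x) 2 4) &&
    rgt (~~ e) (ent (Xi x) 1 3 + ent (Xi x) 2 3)
               (ent (Xi x) 2 4 + ent (Xi x) 3 4),
    ~~ rgt (~~ e) (ent (Xi x) 1 3) (ent (Xi x) 2 4) &&
    rgt (~~ e) (ent (Xi x) 2 3) (ent (Xi x) 3 4) |
    ~~ rgt (~~ e) (ent (Xi x) 2 3) (ent (Xi x) 3 4) &&
    ~~ rgt (~~ e) (ent (Xi x) 1 3 + ent (Xi x) 2 3)
                  (ent (Xi x) 2 4 + ent (Xi x) 3 4)];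
  case: e; rewrite /rgt /gtz /gez /=; [lia | lia | ..];
  rewrite !ent_Xi /= /psum /= => h; solve_move.
Qed.

Lemma unique_move4 (e : bool) (x : XT) : unique_move e 4 x.
Proof.
case: (boolP (rgt (~~ e) (ent (Xi x) 1 4 + ent (Xi x) 3 3 + ent (Xi x) 3 4)
    (ent (Xi x) 2 2 + ent (Xi x) 2 3))); case: e;
  rewrite /rgt /gtz /gez !ent_Xi /= /psum /= => h; solve_move.
Qed.

Lemma unique_move5 (e : bool) (x : XT) : unique_move e 5 x.
Proof.
case: (boolP (rgt (~~ e) (ent (Xi x) 2 4 + ent (Xi x) 4 4)
    (ent (Xi x) 3 3))); case: e;
  rewrite /rgt /gtz /gez !ent_Xi /= /psum /= => h; solve_move.
Qed.

Lemma unique_moveP (e : bool) (k : 'I_6) (x : XT) : unique_move e k x.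
Proof.
case: k => [[|[|[|[|[|[|//]]]]]] ?] /=.
- exact: unique_move0.
- exact: unique_move1.
- exact: unique_move2.
- exact: unique_move3.
- exact: unique_move4.
- exact: unique_move5.
Qed.

(** * The isomorphism *)

Definition Omega_inv (x : XT) : B5inf := Sub (Xi x) (Xi_in x).

Lemma OmegaK : cancel (Omega : B5inf -> XT) Omega_inv.
Proof. by move=> b; apply: val_inj; apply: Xi_OmegaK (valP b). Qed.

Lemma Omega_invK : cancel Omega_inv (Omega : B5inf -> XT).
Proof. by move=> x; apply: Omega_XiK. Qed.

Lemma etil_Omega_inv (k : 'I_6) (x : XT) :
  B_etil k (Omega_inv x) = Some (Omega_inv (X_e 1 k x)).
Proof.
have [cm] := unique_moveP true k x; rewrite /B_etil SubK => -> ->.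
by rewrite (insubT _ (Xi_in _)).
Qed.

Lemma ftil_Omega_inv (k : 'I_6) (x : XT) :
  B_ftil k (Omega_inv x) = Some (Omega_inv (X_e (-1) k x)).
Proof.
have [cm] := unique_moveP false k x; rewrite /B_ftil SubK => -> ->.
by rewrite (insubT _ (Xi_in _)).
Qed.

Theorem theorem4p1 : crystal_isomorphism Omega.
Proof.
split=> [|k b]; first exact: Bijective OmegaK Omega_invK.
have [x ->] : exists x, b = Omega_inv x by exists (Omega b); rewrite OmegaK.
split.
- by rewrite Omega_invK /= etil_Omega_inv /= Omega_invK.
- by rewrite Omega_invK /= ftil_Omega_inv /= Omega_invK.
- by rewrite Omega_invK /=; apply: eq_bigr => i _; rewrite B_wt_Xi.
- by rewrite Omega_invK /= B_eps_Xi.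
- by rewrite Omega_invK /= B_eps_Xi B_wt_Xi addrC.
Qed.
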